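(* Let $\beta_1\le\cdots\le\beta_k$ be the (positive) weights of the servers in an instance of the weighted $k$-server problem on uniform metric spaces, and consider a randomized memoryless algorithm which moves its $i$-th server with probability $p_i>0$ whenever there is no server of the algorithm on the requested point (no ordering of the $p_i$ is assumed). Then the competitive ratio of this algorithm against an online adaptive adversary is at least $\tilde{\alpha}(\beta,p)/(1+s\,\tilde{\alpha}(\beta,p))$, where $s=\max_{1\le i<k}\beta_i/\beta_{i+1}$ and \[\tilde{\alpha}(\beta,p)=\Big(\sum_{j=1}^kp_j\beta_j\Big)\max_{i\in[k]}\frac{\mathbf{I}^{[k]\setminus\{i\}}_{[k]}(p)}{p_i\beta_i}.\]
   Context: Weighted $k$-server problem on uniform metric spaces: any two distinct points are at distance $1$; moving server $i$ to another point costs $\beta_i$; each online request (a point) must be served by having a server there. A memoryless algorithm with distribution $(p_1,\dots,p_k)$ moves server $i$ to an unoccupied requested point with probability $p_i$, independently of the past. An online adaptive adversary generates each request after seeing the algorithm's previous behaviour and serves it immediately with its own servers of the same weights; $c$-competitive means $\mathbb{E}[\text{ALG}]\le c\,\mathbb{E}[\text{ADV}]+b$ for a constant $b$ and all such adversaries; the competitive ratio is the infimum of such $c$. Potentials and currents. Write $[m]=\{1,\dots,m\}$. For positive reals $p_1,p_2,\dots$ and each finite $S\subseteq\mathbb{N}$, a real number $\varphi_S(p)$ (depending only on $p_1,\dots,p_{\max S}$) is defined by induction on the largest element of $S$. For $T$ finite and $i\in T$ write $\mathbf{I}^{T\setminus\{i\}}_T(p)=p_i\big(\varphi_T(p)-\varphi_{T\setminus\{i\}}(p)\big)$.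 Set $\varphi_\emptyset(p)=0$. Given $\varphi_T$ for all $T\subseteq[k-1]$, let the numbers $f_S(p)$, $S\subseteq[k]$ with $k\in S$, be the unique solution of the (strictly diagonally dominant) linear system: for $S\ne[k]$, with $i<k$ the smallest element of $[k]\setminus S$, $\big(p_i+\sum_{j\in S}p_j\big)f_S(p)=p_if_{S\cup\{i\}}(p)+\sum_{j\in S\setminus\{k\}}p_jf_{S\setminus\{j\}}(p)$; and $f_{[k]}(p)=1+\sum_{j=1}^{k-1}\mathbf{I}^{[k-1]\setminus\{j\}}_{[k-1]}(p)$. Then for $S\subseteq[k]$ with $k\in S$ define $\varphi_S(p)=\varphi_{S\setminus\{k\}}(p)+f_S(p)/p_k$. *)

(* Defs.v *)
From HB Require Import structures.
From mathcomp Require Import all_boot all_order all_algebra.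
From mathcomp Require Import boolp classical_sets reals constructive_ereal ereal.
From mathcomp Require Import ring lra.

Set Implicit Arguments.
Unset Strict Implicit.
Unset Printing Implicit Defensive.
Import Order.TTheory GRing.Theory Num.Theory.
Local Open Scope ring_scope.

(* Servers are numbered from 0: server i here is server i.+1 of the usual
   numbering, and [k] = {1, ..., k} becomes 'I_k. Weights and probabilities are
   sequences nat -> R of which only the first k terms are used. *)

(* I_T^{T \ {i}}(p), for a potential phi on the subsets of 'I_k *)
Definition current (R : realType) (k : nat) (p : nat -> R)
    (phi : {set 'I_k} -> R) (T : {set 'I_k}) (i : 'I_k) : R :=
  p i * (phi T - phi (T :\ i)).

(* The linear system for the f_S with S a subset of 'I_k.+1 containing its
   largest element k. Such an S is encoded by T = S \ {k} : {set 'I_k}, so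
   S = [k+1] is T = [set: 'I_k], and the sum of the p_j over S is p k + the sum over
   T. Here phi is the potential on the subsets of 'I_k, and i is the smallest
   element outside T (one exists iff T is not full). *)
Definition is_current_system_solution (R : realType) (k : nat) (p : nat -> R)
    (phi : {set 'I_k} -> R) (f : {ffun {set 'I_k} -> R}) : Prop :=
  (forall (T : {set 'I_k}) (i : 'I_k),
     i \notin T -> (forall j : 'I_k, (j < i)%N -> j \in T) ->
     (p i + (p k + \sum_(j in T) p j)) * f T =
       p i * f (i |: T) + \sum_(j in T) p j * f (T :\ j)) /\
  f [set: 'I_k] = 1 + \sum_(j < k) current p phi [set: 'I_k] j.

(* The value 0 is a junk value: by [current_system_uniq_sol] below the system
   has exactly one solution when p is positive. *)
Definition current_system_sol (R : realType) (k : nat) (p : nat -> R)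
    (phi : {set 'I_k} -> R) : {ffun {set 'I_k} -> R} :=
  xget 0 [set f | is_current_system_solution p phi f]%classic.

(* phi_S(p) for S a subset of 'I_k; by construction the value does not depend
   on the k in which S is viewed. *)
Fixpoint potential (R : realType) (p : nat -> R) (k : nat) :
    {set 'I_k} -> R :=
  match k with
  | 0 => fun _ => 0
  | m.+1 => fun S =>
      let T := [set j : 'I_m | widen_ord (leqnSn m) j \in S] in
      potential p T +
      (if ord_max \in S then current_system_sol p (@potential R p m) T / p m
       else 0)
  end.

(* A uniform metric space is a type of points M, any two distinct points being
   at distance 1. *)
Definition config (k : nat) (M : eqType) : Type := 'I_k -> M.

Definition move_cost (R : realType) (k : nat) (M : eqType) (beta : nat -> R)
    (x y : config k M) : R :=
  \sum_(i < k) beta i * (x i != y i)%:R.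

(* Answer of the memoryless algorithm in configuration a to the request r, when
   its random draw is the server i. *)
Definition alg_step (k : nat) (M : eqType) (a : config k M) (r : M)
    (i : 'I_k) : config k M :=
  if [exists j, a j == r] then a else fun j => if j == i then r else a j.

(* Given the algorithm's configurations so far (most recent first, down to the
   initial one), an online adaptive adversary either stops or chooses the next
   request r together with its own next configuration v, which must cover r.
   It commits to v before the algorithm answers r; its own past is determined
   by the strategy and by the algorithm's past. *)
Record adversary (k : nat) (M : eqType) := Adversary {
  strategy :> seq (config k M) -> option (M * config k M);
  strategy_serves : forall h r v,
    strategy h = Some (r, v) -> exists i : 'I_k, v i = r
}.

(* Costs of (algorithm, adversary) when the algorithm's draws are the elements
   of w, one per request, with a and v the current configurations of the
   algorithm and of the adversary and h the algorithm's previous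
   configurations. *)
Fixpoint run_costs (R : realType) (k : nat) (M : eqType) (beta : nat -> R)
    (adv : adversary k M) (h : seq (config k M)) (a v : config k M)
    (w : seq 'I_k) : R * R :=
  if w is i :: w' then
    if adv (a :: h) is Some (r, v') then
      let a' := alg_step a r i in
      let rest := run_costs beta adv (a :: h) a' v' w' in
      (move_cost beta a a' + rest.1, move_cost beta v v' + rest.2)
    else (0, 0)
  else (0, 0).

(* Expectation over N independent draws of a server with distribution p. *)
Definition expect (R : realType) (k : nat) (p : nat -> R) (N : nat)
    (X : seq 'I_k -> R) : R :=
  \sum_(w : N.-tuple 'I_k) (\prod_(i <- w) p i) * X w.

(* c-competitiveness on uniform metric spaces. N bounds the number of requests,
   and both players start from a0. The constant b may depend on the space and
   on a0, but not on the adversary nor on the number of requests. *)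
Definition competitive (R : realType) (k : nat) (beta p : nat -> R) (c : R) :
    Prop :=
  forall (M : eqType) (a0 : config k M), exists b : R,
    forall (adv : adversary k M) (N : nat),
      expect p N (fun w => (run_costs beta adv [::] a0 a0 w).1) <=
      c * expect p N (fun w => (run_costs beta adv [::] a0 a0 w).2) + b.

Definition competitive_ratio (R : realType) (k : nat) (beta p : nat -> R) :
    \bar R :=
  ereal_inf [set c%:E | c in [set c : R | competitive k beta p c]]%classic.

(* Number of servers: n.+1. The initial value of the iterated maximum is one of
   its terms, so this is the maximum over [k] whatever the signs. *)
Definition alpha_tilde (R : realType) (n : nat) (beta p : nat -> R) : R :=
  let ratio (i : 'I_n.+1) :=
    current p (@potential R p n.+1) [set: 'I_n.+1] i / (p i * beta i) in
  (\sum_(j < n.+1) p j * beta j) * \big[Num.max/ratio ord0]_(i < n.+1) ratio i.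

(* max of beta_i / beta_{i+1} over consecutive servers among n.+1; it is 0 when
   there is a single server (the terms are positive otherwise). *)
Definition weight_gap (R : realType) (n : nat) (beta : nat -> R) : R :=
  \big[Num.max/0]_(i < n) (beta i / beta i.+1).

Lemma first_missing (k : nat) (T : {set 'I_k}) :
  T != [set: 'I_k]%SET ->
  exists2 i : 'I_k, i \notin T & forall j : 'I_k, (j < i)%N -> j \in T.
Proof.
rewrite -finset.subTset => /subsetPn[i0 _ i0T].
case: (@arg_minnP _ i0 (fun i => i \notin T) (fun i => i : nat) i0T) => i iT imin.
exists i => // j ji; apply/negPn/negP => /imin.
by rewrite leqNgt ji.
Qed.

Definition is_first_missing (k : nat) (T : {set 'I_k}) (i : 'I_k) : bool :=
  (i \notin T) && [forall j : 'I_k, (j < i)%N ==> (j \in T)].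

Lemma first_missing_inj (k : nat) (T : {set 'I_k}) (i j : 'I_k) :
  is_first_missing T i -> is_first_missing T j -> i = j.
Proof.
move=> /andP[iT /forallP iF] /andP[jT /forallP jF]; apply/val_inj => /=.
have [ij|ji|//] := ltngtP i j.
  by move: (jF i); rewrite ij (negbTE iT).
by move: (iF j); rewrite ji (negbTE jT).
Qed.

Definition current_op (R : realType) (k : nat) (p : nat -> R)
    (f : {ffun {set 'I_k} -> R^o}) : {ffun {set 'I_k} -> R^o} :=
  [ffun T : {set 'I_k} =>
    if [pick i | is_first_missing T i] is Some i
    then (p i + (p k + \sum_(j in T) p j)) * f T -
         (p i * f (i |: T) + \sum_(j in T) p j * f (T :\ j))
    else f T].

Lemma current_op_linear (R : realType) (k : nat) (p : nat -> R) :
  linear (@current_op R k p).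
Proof.
move=> c f g; apply/ffunP => T; rewrite !ffunE.
case: pickP => [i _|_]; rewrite ?ffunE //.
have -> : \sum_(j in T) p j * (c *: f + g) (T :\ j) =
   c * (\sum_(j in T) p j * f (T :\ j)) + \sum_(j in T) p j * g (T :\ j).
  rewrite mulr_sumr -big_split /=; apply: eq_bigr => j _.
  by rewrite !ffunE mulrDr mulrCA.
rewrite /GRing.scale /=; ring.
Qed.

HB.instance Definition _ (R : realType) (k : nat) (p : nat -> R) :=
  GRing.isLinear.Build R {ffun {set 'I_k} -> R^o} {ffun {set 'I_k} -> R^o} *:%R
    (@current_op R k p) (current_op_linear p).

Lemma current_op_inj (R : realType) (k : nat) (p : nat -> R)
    (f : {ffun {set 'I_k} -> R^o}) :
  (forall i, (i <= k)%N -> 0 < p i) -> current_op p f = 0 -> f = 0.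
Proof.
move=> p0 f0.
have p0' (j : 'I_k) : 0 < p j by apply: p0; exact: ltnW.
case: (@arg_maxP _ _ _ (finset.set0 : {set 'I_k}) predT
  (fun T => `|f T : R|) erefl) => T _ Tmax'.
have Tmax S : `|f S : R| <= `|f T : R| := Tmax' S erefl.
suff fT : f T = 0.
  apply/ffunP => S; rewrite ffunE; apply/eqP.
  by rewrite -(@normr_le0 R R) (le_trans (Tmax S)) // fT normr0.
move/ffunP/(_ T): f0; rewrite !ffunE; case: pickP => [i _|_ //].
move=> /eqP; rewrite subr_eq0 => /eqP fTE.
have s0 : 0 <= \sum_(j in T) p j by apply: sumr_ge0 => j _; exact: ltW.
have pk := p0 k (leqnn k); have pi := p0' i.
have : `|(p i + (p k + \sum_(j in T) p j)) * f T : R| <=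
       p i * `|f T : R| + (\sum_(j in T) p j) * `|f T : R|.
  rewrite fTE (le_trans (ler_normD _ _)) // lerD //.
    by rewrite normrM gtr0_norm // ler_pM2l // Tmax.
  rewrite (le_trans (ler_norm_sum _ _ _)) // mulr_suml ler_sum // => j _.
  by rewrite normrM gtr0_norm // ler_pM2l // Tmax.
rewrite normrM gtr0_norm; last by lra.
have := normr_ge0 (f T : R) => fge0 H.
have : p k * `|f T : R| <= 0 by lra.
by rewrite pmulr_rle0 // normr_le0 => /eqP.
Qed.

Lemma current_system_uniq_sol (R : realType) (k : nat) (p : nat -> R)
    (phi : {set 'I_k} -> R) :
  (forall i, (i <= k)%N -> 0 < p i) ->
  exists! f, is_current_system_solution p phi f.
Proof.
move=> p0.
pose L : 'End({ffun {set 'I_k} -> R^o}) := linfun (@current_op R k p).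
pose rhs : {ffun {set 'I_k} -> R^o} := [ffun T => if T == [set: 'I_k]%SET then
  1 + \sum_(j < k) current p phi [set: 'I_k]%SET j else 0].
have L0 : lker L == 0%VS.
  apply/lker0P => f g; rewrite !lfunE /= => fg.
  apply/eqP; rewrite -subr_eq0; apply/eqP/(current_op_inj p0).
  by rewrite linearB /= fg subrr.
have solP f : is_current_system_solution p phi f <-> current_op p f = rhs.
  split=> [[f1 f2]|/ffunP H].
    apply/ffunP => T; rewrite !ffunE; case: pickP => [i /andP[iT /forallP iF]|].
      rewrite ifF; last by apply: contraNF iT => /eqP ->; rewrite finset.in_setT.
      apply/eqP; rewrite subr_eq0; apply/eqP/f1 => // j ji.
      by move: (iF j); rewrite ji.
    case: eqP => [-> //|/eqP /first_missing[i iT iF] /(_ i)].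
    rewrite /is_first_missing iT /= => /negP; case.
    by apply/forallP => j; apply/implyP => /iF.
  split=> [T i iT iF|].
    have iM : is_first_missing T i.
      by rewrite /is_first_missing iT; apply/forallP => j; apply/implyP => /iF.
    move: (H T); rewrite !ffunE; case: pickP => [j jM|/(_ i)]; last by rewrite iM.
    rewrite (first_missing_inj jM iM) ifF.
      by move=> /eqP; rewrite subr_eq0 => /eqP.
    by apply: contraNF iT => /eqP ->; rewrite finset.in_setT.
  move: (H [set: 'I_k]%SET); rewrite !ffunE eqxx; case: pickP => //.
  by move=> i; rewrite /is_first_missing finset.in_setT.
have LE f : L f = current_op p f by rewrite lfunE.
exists ((L^-1)%VF rhs); split=> [|g /solP gE].
  by apply/solP; rewrite -LE lker0_lfunVK.
by rewrite -gE -LE lker0_lfunK.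
Qed.

(* Main.v *)
(* Call server i matched when the algorithm and the adversary have it at the same
   point. If the adversary keeps requesting the position of its first unmatched
   server i, and no other server of the algorithm is there, the set T of matched
   servers becomes T + i with probability p_i and T - j with probability p_j,
   j in T. The potential phi has drift 1 under this chain, so that going from
   [k] - i0 back to [k] takes phi([k]) - phi([k] - i0) requests on average, each
   costing the algorithm sum_j p_j beta_j. When all servers are matched, the
   adversary restarts the chain by moving i0 to a fresh point, for beta_(i0).
   The obstacle is that a server j > i of the algorithm may come onto the
   requested point, which makes it useless; the adversary then moves i to a fresh
   point, at a cost beta_i <= s beta_j, i.e. at most s times what the algorithm
   paid. No repair is needed when j < i, since j then becomes the first unmatched
   server and leaves the point before i is requested again. With
   K = beta_(i0) / (phi([k]) - phi([k] - i0)) and B = sum_j p_j beta_j, N requests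
   thus cost N B to the algorithm and at most N (K + s B) + O(1) to the
   adversary. *)

Require Import Defs.
From mathcomp Require Import all_boot all_order all_algebra.
From mathcomp Require Import reals constructive_ereal ereal.
From mathcomp Require classical_sets.
From mathcomp Require Import ring lra.
Set Implicit Arguments.
Unset Strict Implicit.
Unset Printing Implicit Defensive.
Import Order.TTheory GRing.Theory Num.Theory.
Local Open Scope ring_scope.

(** * Drift and maximum of the potential *)

Lemma current_system_solP (R : realType) (k : nat) (p : nat -> R)
    (phi : {set 'I_k} -> R) :
  (forall i, (i <= k)%N -> 0 < p i) ->
  is_current_system_solution p phi (current_system_sol p phi).
Proof.
move=> p_gt0; have [f [fP _]] := current_system_uniq_sol phi p_gt0.
exact: (classical_sets.xgetPex 0 (ex_intro _ f fP)).
Qed.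

Section Restriction.
Variable m : nat.
Implicit Types (S : {set 'I_m.+1}) (j : 'I_m).

Let widen : 'I_m -> 'I_m.+1 := widen_ord (leqnSn m).
Let restr S : {set 'I_m} := [set j | widen j \in S].

Lemma restr_setU1 S j : restr (widen j |: S) = j |: restr S.
Proof. by apply/setP => l; rewrite !inE. Qed.

Lemma restr_setD1 S j : restr (S :\ widen j) = restr S :\ j.
Proof. by apply/setP => l; rewrite !inE. Qed.

Lemma restr_setU1_max S : restr (ord_max |: S) = restr S.
Proof. by apply/setP => l; rewrite !inE -val_eqE /= ltn_eqF. Qed.

Lemma restr_setD1_max S : restr (S :\ ord_max) = restr S.
Proof. by apply/setP => l; rewrite !inE -val_eqE /= ltn_eqF. Qed.

End Restriction.

(** Generator of the chain on matched sets, applied to [phi] at [T], where [i] is the server being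
    requested. *)
Definition drift {R : realType} {k : nat} (p : nat -> R) (phi : {set 'I_k} -> R)
    (T : {set 'I_k}) (i : 'I_k) : R :=
  p i * (phi (i |: T) - phi T) + \sum_(j in T) p j * (phi (T :\ j) - phi T).

(** Induction on the number of servers. Adding server [m] changes the potential only on sets
    containing [m], by [f T / p m], and the linear system defining [f] is exactly what keeps the
    drift equal to 1. *)
Lemma potential_drift (R : realType) (k : nat) (p : nat -> R) :
  (forall i, (i < k)%N -> 0 < p i) ->
  forall (T : {set 'I_k}) (i : 'I_k),
    is_first_missing T i -> drift p (potential p (k:=k)) T i = 1.
Proof.
elim: k => [|m IH] p_gt0 S i; first by case: i.
have p_gt0' l : (l < m)%N -> 0 < p l by move=> lm; apply/p_gt0/ltnW.
have pm0 : p m != 0 by rewrite gt_eqF // p_gt0.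
have widen_neq (j : 'I_m) : (ord_max == widen_ord (leqnSn m) j) = false.
  by rewrite -val_eqE /= gtn_eqF.
have [f1 f2] := @current_system_solP R m p (potential p (k:=m)) p_gt0.
rewrite /drift big_mkcond big_ord_recr -big_mkcond /=.
set f := current_system_sol _ _ in f1 f2 *.
set T := [set j | _ \in S].
case: (unliftP ord_max i) => [i'|] ->{i}.
  have -> : lift ord_max i' = widen_ord (leqnSn m) i'.
    by apply/val_inj; rewrite /= /bump leqNgt ltn_ord.
  move=> /andP[iS /forallP iF].
  have iT : i' \notin T by rewrite inE.
  have iF' (j : 'I_m) : (j < i')%N -> j \in T.
    by move=> ji; move: (iF (widen_ord (leqnSn m) j)); rewrite /= ji inE.
  have iM : is_first_missing T i'.
    by rewrite /is_first_missing iT; apply/forallP => j; apply/implyP/iF'.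
  have /= := IH p_gt0' T i' iM; rewrite /drift => drT.
  have := f1 T i' iT iF' => fT.
  rewrite restr_setU1 restr_setD1_max -/T !inE widen_neq /= eqxx /=.
  under eq_bigr => j jS do rewrite restr_setD1 -/T !inE widen_neq /=.
  rewrite (eq_bigl (mem T)); last by move=> j; rewrite /= !inE.
  case: ifP => mS; last first.
    by rewrite !addr0 -[RHS]drT; congr (_ + _); apply: eq_bigr => j _; rewrite !addr0.
  have e : \sum_(j in T) p j * (potential p (T :\ j) + f (T :\ j) / p m -
            (potential p T + f T / p m)) =
      \sum_(j in T) p j * (potential p (T :\ j) - potential p T) +
      ((\sum_(j in T) p j * f (T :\ j)) - (\sum_(j in T) p j) * f T) / p m.
    rewrite mulr_suml -sumrB mulr_suml -big_split /=; apply: eq_bigr => j _.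
    by field.
  rewrite e -[RHS]drT.
  (* By the system at [T], the [f] terms of the moves of servers other than [m] add up to [f T]; the
     loss of server [m] contributes [- f T]. *)
  have -> : \sum_(j in T) p j * f (T :\ j) =
    (p i' + (p m + \sum_(j in T) p j)) * f T - p i' * f (i' |: T).
    by rewrite fT; ring.
  by field.
(* Now [m] itself is the first missing server, so all the others are matched. The gain
   [p m * (f T / p m)] is the value of [f] at the full set: 1 plus the currents lost through the
   other servers. *)
move=> /andP[iS /forallP iF].
have TE : T = [set: 'I_m].
  apply/setP => j; rewrite !inE.
  by move: (iF (widen_ord (leqnSn m) j)); rewrite /= ltn_ord.
rewrite restr_setU1_max !inE eqxx /= (negbTE iS) -/T !addr0.
under eq_bigr => j jS do rewrite restr_setD1 -/T !inE widen_neq /= (negbTE iS) !addr0.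
rewrite (eq_bigl predT); last first.
  by move=> j /=; have := in_setT j; rewrite -TE inE.
rewrite TE f2 mulrC [_ + _ / _]addrC addrK divfK // -addrA -big_split /=.
rewrite big1 ?addr0 // => j _; rewrite /current; ring.
Qed.

(** At a maximiser with a missing server every term of the drift would be nonpositive, against drift
    1. Hence the full set is the only maximiser. *)
Lemma potential_lt_full (R : realType) (k : nat) (p : nat -> R) :
  (forall i, (i < k)%N -> 0 < p i) ->
  forall T : {set 'I_k}, T != [set: 'I_k] ->
    potential p T < potential p [set: 'I_k].
Proof.
move=> p_gt0.
case: (@arg_maxP _ _ _ (set0 : {set 'I_k}) predT (potential p (k:=k)) erefl).
move=> S _ Smax'; have Smax T : potential p T <= potential p S := Smax' T erefl.
have full T : (forall U : {set 'I_k}, potential p U <= potential p T) -> T = [set: 'I_k].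
  move=> Tmax; apply/eqP/negPn/negP => /first_missing[i iT iF].
  have iM : is_first_missing T i.
    by rewrite /is_first_missing iT; apply/forallP => j; apply/implyP/iF.
  have := potential_drift p_gt0 iM; rewrite /drift => drT.
  have : p i * (potential p (i |: T) - potential p T) <= 0.
    by rewrite pmulr_rle0 ?p_gt0 // subr_le0.
  have : \sum_(j in T) p j * (potential p (T :\ j) - potential p T) <= 0.
    by apply: sumr_le0 => j _; rewrite pmulr_rle0 ?p_gt0 // subr_le0.
  lra.
rewrite -(full S Smax) => T TS; rewrite lt_neqAle Smax andbT.
apply: contra_neqN TS => /eqP TE; rewrite (full S Smax); apply: full => U.
by rewrite TE.
Qed.

(** * Expectation over independent draws *)

Lemma expectS (R : realType) (k : nat) (p : nat -> R) (N : nat) (X : seq 'I_k -> R) :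
  expect p N.+1 X = \sum_(i < k) p i * expect p N (fun w => X (i :: w)).
Proof.
rewrite /expect; under [RHS]eq_bigr do rewrite mulr_sumr.
rewrite pair_big /= (reindex (fun q : 'I_k * N.-tuple 'I_k => [tuple of q.1 :: q.2])) /=.
  by apply: eq_bigr => -[i w] _ /=; rewrite big_cons mulrA.
exists (fun w => (thead w, [tuple of behead w])) => [[i w]|w] _ /=.
  by congr pair; apply/val_inj.
by case/tupleP: w => i w; apply/val_inj.
Qed.

Lemma expect0 (R : realType) (k : nat) (p : nat -> R) (X : seq 'I_k -> R) :
  expect p 0 X = X [::].
Proof.
rewrite /expect (big_pred1 [tuple]) => [|w]; first by rewrite big_nil mul1r.
by rewrite (tuple0 w) /= eqxx.
Qed.

Lemma expect_addl (R : realType) (k : nat) (p : nat -> R) (N : nat) (x : R)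
    (X : seq 'I_k -> R) :
  \sum_(i < k) p i = 1 ->
  expect p N (fun w => x + X w) = x + expect p N X.
Proof.
move=> p1; elim: N X => [|N IH] X; first by rewrite !expect0.
rewrite !expectS -[x in RHS]mul1r -p1 mulr_suml -big_split /=.
by apply: eq_bigr => i _; rewrite IH mulrDr.
Qed.

(** * The adversary's strategy and its invariant *)

Section Play.
Variables (n : nat) (i0 : 'I_n.+1).
Implicit Types (a v : config n.+1 nat) (i j l : 'I_n.+1).

Definition covered a (x : nat) : bool := [exists j, a j == x].

Definition matched a v : {set 'I_n.+1} := [set i | a i == v i].

(** The default [i0] is the server with which the adversary restarts the chain when everything is
    matched. *)
Definition target a v : 'I_n.+1 :=
  odflt i0 [pick i | is_first_missing (matched a v) i].

Definition fresh a v : nat := (\max_i a i + \max_i v i).+1.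

Definition adv_step a v : config n.+1 nat :=
  let i := target a v in
  if covered a (v i) then fun j => if j == i then fresh a v else v j else v.

(** A strategy sees only the algorithm's past, so the adversary's own configuration is recomputed
    from it. *)
Fixpoint adv_config (h : seq (config n.+1 nat)) : config n.+1 nat :=
  if h is a :: h' then adv_step a (adv_config h') else fun i => i.

(** The target is chosen before the adversary's move, and requested at its position after that
    move. *)
Definition adv_strategy (h : seq (config n.+1 nat)) :
    option (nat * config n.+1 nat) :=
  if h is a :: h' then
    let v := adv_config h in Some (v (target a (adv_config h')), v)
  else None.

Lemma adv_strategy_serves h r v : adv_strategy h = Some (r, v) -> exists i, v i = r.
Proof. by case: h => [//|a h] /= [<- <-]; exists (target a (adv_config h)). Qed.

Definition play_adversary : adversary n.+1 nat := Adversary adv_strategy_serves.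

(* If a j = v l with j < l, then j is unmatched, hence becomes the target and
   leaves v l before l does. *)
Definition tidy a v : Prop := forall j l, a j = v l -> (j <= l)%N.

(* [tidy] may fail at the target only, from where the next [adv_step] escapes. *)
Definition play_inv a v : Prop :=
  injective v /\ forall j l, a j = v l -> (j <= l)%N \/ l = target a v.

Lemma fresh_a a v j : (a j < fresh a v)%N.
Proof.
by rewrite /fresh ltnS (leq_trans _ (leq_addr _ _)) // (leq_bigmax j).
Qed.

Lemma fresh_v a v j : (v j < fresh a v)%N.
Proof.
by rewrite /fresh ltnS (leq_trans _ (leq_addl _ _)) // (leq_bigmax j).
Qed.

Lemma is_first_missing_target a v :
  matched a v != [set: 'I_n.+1] -> is_first_missing (matched a v) (target a v).
Proof.
move=> /first_missing[i iT iF]; rewrite /target; case: pickP => [//|/(_ i)].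
rewrite /is_first_missing iT => /negP[]; apply/forallP => j.
by apply/implyP/iF.
Qed.

Lemma target_full a v : matched a v = [set: 'I_n.+1] -> target a v = i0.
Proof.
move=> mT; rewrite /target mT; case: pickP => // i.
by rewrite /is_first_missing in_setT.
Qed.

Lemma first_missing_target a v i :
  is_first_missing (matched a v) i -> target a v = i.
Proof.
move=> iM; rewrite /target; case: pickP => [j jM|/(_ i)]; last by rewrite iM.
exact: first_missing_inj jM iM.
Qed.

Lemma is_first_missingP (T : {set 'I_n.+1}) i :
  is_first_missing T i -> i \notin T /\ forall j, (j < i)%N -> j \in T.
Proof.
by move=> /andP[iT /forallP iF]; split=> // j ji; move: (iF j); rewrite ji.
Qed.

(* Either the target was uncovered, hence missing, or it has just moved to a
   fresh point. *)
Lemma adv_stepP a v (i := target a v) (v' := adv_step a v) : play_inv a v ->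
  [/\ injective v', tidy a v', is_first_missing (matched a v') i,
      ~~ covered a (v' i) &
      matched a v' = if matched a v == [set: _] then [set: _] :\ i0 else matched a v].
Proof.
move=> [v_inj av]; rewrite /v' /adv_step -/i.
have [cov|ncov] := boolP (covered a (v i)).
  set w := fun j => _.
  have wi : w i = fresh a v by rewrite /w eqxx.
  have wE j : j != i -> w j = v j by rewrite /w => /negbTE ->.
  have awi j : a j != w i by rewrite wi neq_ltn fresh_a.
  have mE : matched a w = matched a v :\ i.
    apply/setP => j; rewrite !inE; have [->|ji] /= := eqVneq j i.
      exact/negbTE.
    by rewrite wE.
  have mE' : matched a w = if matched a v == [set: _] then [set: _] :\ i0 else matched a v.
    rewrite mE; case: eqP => [mT|/eqP mT]; first by rewrite /i mT target_full.
    (* If some server is unmatched, the target is already missing, so removing it changes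
       nothing. *)
    have [iN _] := is_first_missingP (is_first_missing_target mT).
    apply/setP => j; rewrite !inE; case: eqVneq => //= ->.
    by move: iN; rewrite inE => /negbTE.
  split => //.
  - move=> j l; rewrite /w; have [->|ji] := eqVneq j i; have [->|li] := eqVneq l i => //.
    + by move=> e; have := fresh_v a v l; rewrite -e ltnn.
    + by move=> e; have := fresh_v a v j; rewrite e ltnn.
    + exact: v_inj.
  - move=> j l; have [->|li] := eqVneq l i; first by move/eqP; rewrite (negbTE (awi j)).
    by rewrite wE // => /av[//|e]; rewrite e eqxx in li.
  - case: (eqVneq (matched a v) [set: _]) => mT.
      rewrite /is_first_missing mE mT !inE eqxx /=.
      by apply/forallP => j; apply/implyP => ji; rewrite !inE andbT neq_ltn ji.
    by rewrite mE' (negbTE mT); exact: is_first_missing_target.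
  - by apply/negP => /existsP[j]; apply/negP.
have mT : matched a v != [set: _].
  apply: contra ncov => /eqP mT; apply/existsP; exists i.
  by have := in_setT i; rewrite -mT inE.
rewrite (negbTE mT); split => //; last exact: is_first_missing_target.
(* The only exception to [tidy] that the invariant allows would cover the target. *)
move=> j l e; case: (av _ _ e) => // li; move: ncov; rewrite /covered.
by move=> /existsPn /(_ j); rewrite e li eqxx.
Qed.

Lemma alg_stepE a r i : ~~ covered a r ->
  alg_step a r i = fun j => if j == i then r else a j.
Proof. by rewrite /covered /alg_step => /negbTE ->. Qed.

Lemma matched_alg_step a v i l :
  injective v -> ~~ covered a (v i) ->
  matched (alg_step a (v i) l) v =
    if l == i then i |: matched a v else matched a v :\ l.
Proof.
move=> v_inj nc; rewrite alg_stepE //.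
have [->|li] := eqVneq l i; apply/setP => j; rewrite !inE.
  by case: (eqVneq j i) => //= ->; rewrite eqxx.
case: (eqVneq j l) => //= ->.
by apply/negbTE; apply: contra_neqN li => /eqP /v_inj ->.
Qed.

Lemma alg_step_tidy a v i l :
  injective v -> tidy a v -> (l <= i)%N -> ~~ covered a (v i) ->
  tidy (alg_step a (v i) l) v.
Proof.
move=> v_inj td li nc j k; rewrite alg_stepE //.
by case: (eqVneq j l) => [-> /v_inj <- //|_]; exact: td.
Qed.

(** By [tidy], a server on the target's point has index at most that of the target. The target
    itself is unmatched, and smaller servers are matched, hence at other points since [v] is
    injective. *)
Lemma tidy_target_uncovered a v :
  injective v -> tidy a v -> matched a v != [set: _] ->
  ~~ covered a (v (target a v)).
Proof.
move=> v_inj td /is_first_missing_target/is_first_missingP[iN iF].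
apply/negP => /existsP[j /eqP e].
have := td _ _ e; rewrite leq_eqVlt => /orP[/eqP/val_inj ji|/iF].
  by move: iN; rewrite inE -{1}ji e eqxx.
rewrite inE e => /eqP /v_inj ti.
by move: iN; rewrite inE -{1}ti in e *; rewrite e eqxx.
Qed.

(** Losing a server beyond [i] does not change which server is first missing, so the only new
    coincidence occurs at the target. *)
Lemma alg_step_late a v i l :
  injective v -> tidy a v -> is_first_missing (matched a v) i ->
  ~~ covered a (v i) -> (i < l)%N ->
  target (alg_step a (v i) l) v = i /\ play_inv (alg_step a (v i) l) v.
Proof.
move=> v_inj td iM nc il.
have li : l != i by rewrite neq_ltn il orbT.
have tE : target (alg_step a (v i) l) v = i.
  apply: first_missing_target; rewrite matched_alg_step // (negbTE li).
  have [iN iF] := is_first_missingP iM.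
  rewrite /is_first_missing in_setD1 negb_and iN orbT /=; apply/forallP => j; apply/implyP => ji.
  by rewrite in_setD1 iF // andbT neq_ltn (ltn_trans ji il).
split => //; split => // j k; rewrite tE alg_stepE //.
by case: (eqVneq j l) => [_ /v_inj ->|_ /td]; [right|left].
Qed.

Lemma alg_step_early a v i l :
  injective v -> tidy a v -> ~~ covered a (v i) -> (l <= i)%N ->
  play_inv (alg_step a (v i) l) v.
Proof.
by move=> vi td nc li; split=> // j k e; left; apply: (alg_step_tidy vi td li nc).
Qed.

End Play.

(** * Move costs and the weight gap *)

Lemma move_cost_one (R : realType) (k : nat) (M : eqType) (beta : nat -> R)
    (x : config k M) (i : 'I_k) (y : M) : x i != y ->
  move_cost beta x (fun j => if j == i then y else x j) = beta i.
Proof.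
move=> xy; rewrite /move_cost (bigD1 i) //= eqxx xy mulr1 big1 ?addr0 // => j ji.
by rewrite (negbTE ji) eqxx mulr0.
Qed.

Lemma move_cost_same (R : realType) (k : nat) (M : eqType) (beta : nat -> R)
    (x : config k M) : move_cost beta x x = 0.
Proof. by rewrite /move_cost big1 // => j _; rewrite eqxx mulr0. Qed.

(** Monotonicity raises [beta i] to the weight just before [beta l]; one consecutive ratio then
    suffices. *)
Lemma weight_gap_ge (R : realType) (n : nat) (beta : nat -> R) :
  (forall i, (i < n.+1)%N -> 0 < beta i) ->
  (forall i j, (i <= j)%N -> (j < n.+1)%N -> beta i <= beta j) ->
  forall i l, (i < l)%N -> (l < n.+1)%N -> beta i <= weight_gap n beta * beta l.
Proof.
move=> b_gt0 b_mono i [//|l] il ln.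
rewrite (le_trans (b_mono i l il (ltnW ln))) //.
rewrite -ler_pdivrMr ?b_gt0 // /weight_gap.
exact: (le_bigmax 0 (fun i : 'I_n => beta i / beta i.+1) (Ordinal (ln : (l < n)%N))).
Qed.

Lemma weight_gap_ge0 (R : realType) (n : nat) (beta : nat -> R) :
  0 <= weight_gap n beta.
Proof. exact: bigmax_ge_id. Qed.

Local Arguments potential : simpl never.

(** * Expected costs of both players *)

Section Costs.
Variables (R : realType) (n : nat) (i0 : 'I_n.+1) (beta p : nat -> R).
Hypothesis beta_gt0 : forall i, (i < n.+1)%N -> 0 < beta i.
Hypothesis beta_sorted :
  forall i j, (i <= j)%N -> (j < n.+1)%N -> beta i <= beta j.
Hypothesis p_gt0 : forall i, (i < n.+1)%N -> 0 < p i.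
Hypothesis p_sum1 : \sum_(i < n.+1) p i = 1.

Let adv := play_adversary i0.
Let B : R := \sum_(j < n.+1) p j * beta j.
Let s : R := weight_gap n beta.
Let Delta : R := potential p [set: 'I_n.+1] - potential p ([set: 'I_n.+1] :\ i0).
Let K : R := beta i0 / Delta.
Implicit Types (a v : config n.+1 nat) (h : seq (config n.+1 nat)) (i l : 'I_n.+1).

Definition adv_cost a v : R :=
  if covered a (v (target i0 a v)) then beta (target i0 a v) else 0.

(* What the adversary owes for dislodging a server of the algorithm that came
   onto its missing server. *)
Definition debt a v : R :=
  if matched a v == [set: 'I_n.+1] then 0 else adv_cost a v.

Lemma adv_cost_ge0 a v : 0 <= adv_cost a v.
Proof. by rewrite /adv_cost; case: ifP => // _; exact/ltW/beta_gt0. Qed.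

Lemma adv_cost_le a v : adv_cost a v <= beta (target i0 a v).
Proof. by rewrite /adv_cost; case: ifP => // _; exact/ltW/beta_gt0. Qed.

Lemma debt_ge0 a v : 0 <= debt a v.
Proof. by rewrite /debt; case: ifP => // _; exact: adv_cost_ge0. Qed.

Lemma move_cost_adv_step a v : move_cost beta v (adv_step i0 a v) = adv_cost a v.
Proof.
rewrite /adv_step /adv_cost; case: ifP => _; last exact: move_cost_same.
by apply: move_cost_one; rewrite neq_ltn fresh_v.
Qed.

Lemma alg_step_inv h a l (v' := adv_config i0 (a :: h))
    (i := target i0 a (adv_config i0 h)) :
  play_inv i0 a (adv_config i0 h) -> play_inv i0 (alg_step a (v' i) l) v'.
Proof.
move=> /adv_stepP[v_inj td iM nc _].
have [li|il] := leqP l i; first exact: alg_step_early.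
by case: (alg_step_late i0 v_inj td iM nc il).
Qed.

(** After the adversary's move the requested point is uncovered, so whichever server is drawn really
    moves: the mean cost is [B] in every configuration. *)
Lemma expect_run_costsS (h : seq (config n.+1 nat)) a N
    (v' := adv_config i0 (a :: h)) (i := target i0 a (adv_config i0 h))
    (v := adv_config i0 h) :
  play_inv i0 a v ->
  expect p N.+1 (fun w => (run_costs beta adv h a v w).1) =
    B + \sum_(l < n.+1) p l * expect p N
      (fun w => (run_costs beta adv (a :: h) (alg_step a (v' i) l) v' w).1) /\
  expect p N.+1 (fun w => (run_costs beta adv h a v w).2) =
    adv_cost a v + \sum_(l < n.+1) p l * expect p N
      (fun w => (run_costs beta adv (a :: h) (alg_step a (v' i) l) v' w).2).
Proof.
move=> /adv_stepP[_ _ _ nc _]; rewrite !expectS -[adv_cost a v]mul1r -p_sum1 mulr_suml.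
rewrite /B -!big_split /=; split; apply: eq_bigr => l _; rewrite -mulrDr -expect_addl //.
  rewrite [X in move_cost _ _ X]alg_stepE // move_cost_one //.
  by apply: contra nc => /eqP e; apply/existsP; exists l; apply/eqP.
by rewrite -/v -move_cost_adv_step.
Qed.

Lemma expect_alg_cost N h a : play_inv i0 a (adv_config i0 h) ->
  expect p N (fun w => (run_costs beta adv h a (adv_config i0 h) w).1) = N%:R * B.
Proof.
elim: N h a => [|N IH] h a inv; first by rewrite expect0 mul0r.
have [-> _] := expect_run_costsS N inv.
rewrite (eq_bigr (fun l : 'I_n.+1 => p l * (N%:R * B))) => [|l _].
  by rewrite -mulr_suml p_sum1 mul1r -[N.+1]add1n natrD mulrDl mul1r.
by congr (_ * _); apply: IH; exact: alg_step_inv.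
Qed.

Lemma Delta_gt0 : 0 < Delta.
Proof.
rewrite subr_gt0 potential_lt_full //.
by apply/eqP => /setP/(_ i0); rewrite !inE eqxx.
Qed.

(** A restart costs [beta i0 = K * Delta], exactly the drop of [K] times the potential. Any other
    move leaves the matched set unchanged and pays the debt. *)
Lemma adv_cost_amortized a v : play_inv i0 a v ->
  adv_cost a v + K * potential p (matched a (adv_step i0 a v)) =
  K * potential p (matched a v) + debt a v.
Proof.
move=> /adv_stepP[_ _ _ _ ->]; rewrite /debt; case: eqP => [mT|_]; last by rewrite addrC.
have cov : covered a (v i0).
  by apply/existsP; exists i0; have := in_setT i0; rewrite -mT inE.
rewrite /adv_cost (target_full i0 mT) cov mT addr0 /K.
have := Delta_gt0; rewrite /Delta => /lt0r_neq0 D0.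
by field.
Qed.

(** This is drift 1 written as a mean over draws: a draw outside [T] other than [i] leaves the
    matched set [T] unchanged. *)
Lemma sum_potential_alg_step a v i :
  injective v -> is_first_missing (matched a v) i -> ~~ covered a (v i) ->
  \sum_(l < n.+1) p l * potential p (matched (alg_step a (v i) l) v) =
  1 + potential p (matched a v).
Proof.
move=> v_inj iM nc; rewrite -(potential_drift p_gt0 iM) /drift.
set T := matched a v; have [iN _] := is_first_missingP iM.
rewrite (bigD1 i) //= matched_alg_step // eqxx -/T.
have e : potential p T =
    p i * potential p T + \sum_(j < n.+1 | j != i) p j * potential p T.
  by rewrite -[LHS]mul1r -p_sum1 mulr_suml (bigD1 i).
have -> : \sum_(j in T) p j * (potential p (T :\ j) - potential p T) =
    \sum_(j < n.+1 | j != i) p j * (potential p (T :\ j) - potential p T).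
  rewrite [RHS](bigID (mem T)) /= [X in _ + X]big1 ?addr0.
    by apply: eq_bigl => j; case: eqVneq => //= ->; exact: negbTE.
  move=> j /andP[_ jT]; suff -> : T :\ j = T by rewrite subrr mulr0.
  by apply/setP => l; rewrite in_setD1; case: eqVneq => //= ->; exact/esym/negbTE.
have -> : \sum_(l < n.+1 | l != i) p l * potential p (matched (alg_step a (v i) l) v) =
   \sum_(j < n.+1 | j != i) p j * (potential p (T :\ j) - potential p T) +
   \sum_(j < n.+1 | j != i) p j * potential p T.
  rewrite -big_split /=; apply: eq_bigr => l li.
  by rewrite matched_alg_step // (negbTE li) -/T; ring.
by rewrite [X in _ = _ + X]e; ring.
Qed.

(** A draw [l <= i] keeps the configuration tidy and creates no debt. A draw [l > i] creates at most
    [beta i <= s * beta l]. *)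
Lemma sum_debt_alg_step a v i :
  injective v -> tidy a v -> is_first_missing (matched a v) i ->
  ~~ covered a (v i) ->
  \sum_(l < n.+1) p l * debt (alg_step a (v i) l) v <= s * B.
Proof.
move=> v_inj td iM nc; rewrite /B mulr_sumr ler_sum // => l _.
rewrite mulrCA ler_pM2l ?p_gt0 // /debt.
have sb0 : 0 <= s * beta l.
  by rewrite mulr_ge0 ?weight_gap_ge0 ?ltW ?beta_gt0.
case: eqVneq => // mT; have [li|il] := leqP l i.
  have td' := alg_step_tidy v_inj td li nc.
  by rewrite /adv_cost (negbTE (tidy_target_uncovered i0 v_inj td' mT)).
rewrite (le_trans (adv_cost_le _ _)) //.
have [-> _] := alg_step_late i0 v_inj td iM nc il.
exact: weight_gap_ge.
Qed.

Lemma expect_adv_cost_ge0 N h a : play_inv i0 a (adv_config i0 h) ->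
  0 <= expect p N (fun w => (run_costs beta adv h a (adv_config i0 h) w).2).
Proof.
elim: N h a => [|N IH] h a inv; first by rewrite expect0.
have [_ ->] := expect_run_costsS N inv.
rewrite addr_ge0 ?adv_cost_ge0 // sumr_ge0 // => l _.
by apply: mulr_ge0; [exact/ltW/p_gt0|apply: IH; exact: alg_step_inv].
Qed.

(** Amortised induction: each request raises the mean potential by 1, which accounts for [K], and
    creates mean debt at most [s * B]. Subtracting the lower bound [m] keeps the potential term
    nonnegative when [N = 0]. *)
Lemma expect_adv_cost_le m N h a (v := adv_config i0 h) :
  (forall T : {set 'I_n.+1}, m <= potential p T) -> play_inv i0 a v ->
  expect p N (fun w => (run_costs beta adv h a v w).2) <=
  N%:R * (K + s * B) + K * (potential p (matched a v) - m) + debt a v.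
Proof.
move=> mP; elim: N h a @v => [|N IH] h a v inv.
  rewrite expect0 /= mul0r add0r addr_ge0 ?debt_ge0 // mulr_ge0 ?subr_ge0 //.
  by rewrite divr_ge0 ?ltW ?Delta_gt0 ?beta_gt0.
have [_ ->] := expect_run_costsS N inv; rewrite -/v.
have amort := adv_cost_amortized inv.
have [v_inj td iM nc _] := adv_stepP inv.
set v' := adv_config i0 (a :: h); set i := target i0 a v.
rewrite -[adv_step i0 a v]/v' in amort v_inj td iM nc.
rewrite -/i in iM nc.
have sumW := sum_potential_alg_step v_inj iM nc.
have sumD := sum_debt_alg_step v_inj td iM nc.
set X := \sum_(l < n.+1) _.
have : X <= N%:R * (K + s * B) + K * (1 + potential p (matched a v') - m) + s * B.
  apply: (@le_trans _ _ (\sum_(l < n.+1) p l * (N%:R * (K + s * B) +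
     K * (potential p (matched (alg_step a (v' i) l) v') - m) +
     debt (alg_step a (v' i) l) v'))).
    apply: ler_sum => l _; rewrite ler_pM2l ?p_gt0 //.
    by apply: IH; exact: alg_step_inv.
  have -> : \sum_(l < n.+1) p l * (N%:R * (K + s * B) +
     K * (potential p (matched (alg_step a (v' i) l) v') - m) +
     debt (alg_step a (v' i) l) v') =
     (\sum_(l < n.+1) p l) * (N%:R * (K + s * B) - K * m) +
     K * (\sum_(l < n.+1) p l * potential p (matched (alg_step a (v' i) l) v')) +
     \sum_(l < n.+1) p l * debt (alg_step a (v' i) l) v'.
    by rewrite mulr_suml (mulr_sumr _ _ _ K) -!big_split /=; apply: eq_bigr => l _; ring.
  rewrite sumW p_sum1; lra.
by rewrite -[N.+1]add1n natrD; lra.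
Qed.

End Costs.

(** * Conclusion for arbitrarily long request sequences *)

Lemma natr_mul_bounded_le0 (R : realType) (x y : R) :
  (forall N : nat, N%:R * x <= y) -> x <= 0.
Proof.
move=> H; rewrite leNgt; apply/negP => x0.
have := archi_boundP (normr_ge0 (y / x)); set N := Num.bound _ => yN.
have := H N; rewrite leNgt -ltr_pdivrMr // (le_lt_trans _ yN) //.
exact: ler_norm.
Qed.

Theorem theorem4 (R : realType) (n : nat) (beta p : nat -> R)
    (beta_gt0 : forall i, (i < n.+1)%N -> 0 < beta i)
    (beta_sorted : forall i j, (i <= j)%N -> (j < n.+1)%N -> beta i <= beta j)
    (p_gt0 : forall i, (i < n.+1)%N -> 0 < p i)
    (p_sum1 : \sum_(i < n.+1) p i = 1) :
  ((alpha_tilde n beta p /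
      (1 + weight_gap n beta * alpha_tilde n beta p))%:E
   <= competitive_ratio n.+1 beta p)%E.
Proof.
apply: le_ereal_inf_tmp => _ [c comp_c <-]; rewrite lee_fin.
pose ratio (i : 'I_n.+1) :=
  current p (potential p (k:=n.+1)) [set: 'I_n.+1] i / (p i * beta i).
have [i0 _ i0max'] := @arg_maxP _ _ _ (ord0 : 'I_n.+1) predT ratio erefl.
set B := \sum_(j < n.+1) p j * beta j; set s := weight_gap n beta.
have -> : alpha_tilde n beta p = B * ratio i0.
  congr (_ * _); apply/le_anti/andP; split; last exact: (le_bigmax (ratio ord0) ratio i0).
  by apply: bigmax_le => [|i _]; exact: i0max'.
set D := potential p [set: 'I_n.+1] - potential p ([set: 'I_n.+1] :\ i0).
have D0 : 0 < D := Delta_gt0 i0 p_gt0.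
have b0 : 0 < beta i0 by exact: beta_gt0.
have p0 : 0 < p i0 by exact: p_gt0.
have B0 : 0 < B.
  rewrite /B big_ord_recl ltr_wpDr ?mulr_gt0 ?p_gt0 ?beta_gt0 // sumr_ge0 // => j _.
  by rewrite ltW // mulr_gt0 ?p_gt0 ?beta_gt0 ?ltn_ord.
have s0 : 0 <= s by exact: weight_gap_ge0.
have -> : ratio i0 = D / beta i0.
  by rewrite /ratio /current -/D; field; rewrite !gt_eqF.
have K0 : 0 < beta i0 / D by rewrite divr_gt0.
have KB0 : 0 < beta i0 / D + s * B by rewrite ltr_wpDr // mulr_ge0 // ltW.
(* Numerator and denominator are divided by [D / beta i0], which exhibits the quotient of the two
   costs per request. *)
have -> : B * (D / beta i0) / (1 + s * (B * (D / beta i0))) = B / (beta i0 / D + s * B).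
  field; rewrite !gt_eqF //=.
  by rewrite ltr_wpDr // mulr_ge0 ?(ltW D0) // mulr_ge0 ?(ltW B0).
rewrite ler_pdivrMr // -subr_le0.
pose v0 : config n.+1 nat := fun i => i.
have [b bP] := comp_c nat v0.
have inv0 : play_inv i0 v0 (adv_config i0 [::]).
  by split=> [j l /val_inj //|j l e]; left; rewrite -[nat_of_ord j]/(v0 j) e.
have [T _ Tmin'] := @arg_minP _ _ _ (set0 : {set 'I_n.+1}) predT (potential p (k:=n.+1)) erefl.
have Tmin S : potential p T <= potential p S := Tmin' S erefl.
set C := beta i0 / D * (potential p (matched v0 v0) - potential p T) + debt i0 beta v0 v0.
have H N : N%:R * B <= c * expect p N (fun w =>
    (run_costs beta (play_adversary i0) [::] v0 v0 w).2) + b.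
  by rewrite -(expect_alg_cost beta p_sum1 N inv0); exact: bP.
have E0 N := expect_adv_cost_ge0 beta_gt0 p_gt0 p_sum1 N inv0.
have E1 N := expect_adv_cost_le beta_gt0 beta_sorted p_gt0 p_sum1 N Tmin inv0.
(* The upper bound on the adversary's cost can be multiplied by [c] only if [c >= 0]. For negative
   [c], nonnegativity of that cost gives [N%:R * B <= b] for all [N], contradicting [0 < B]. *)
have [c0|c0] := leP 0 c.
  apply: (@natr_mul_bounded_le0 _ _ (c * C + b)) => N.
  have := H N; have := ler_wpM2l c0 (E1 N).
  rewrite -/B -/s -/D /C; lra.
have : B <= 0.
  apply: (@natr_mul_bounded_le0 _ _ b) => N; rewrite (le_trans (H N)) //.
  by rewrite gerDr nmulr_rle0.
lra.
Qed.
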